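(* Let $X$ be a regular diffusion on an interval $I\subset\mathbb{R}$ with speed measure $m^X$ and transition density $q_t(\cdot,\cdot)$ with respect to $m^X$. Let $T>0$, $x\in(a,b)\subset I$ and $y\in I\setminus(a,b)$. Let $\mathcal{T}_{(a,b)}$ be the first exit time from $(a,b)$, and let $\widehat q_t(\cdot,\cdot)$ be the transition density with respect to $m^X$ of $X$ killed at $\mathcal{T}_{(a,b)}$. Then the mean exit time of the $X$-bridge from $x$ to $y$ of length $T$ satisfies $$\mathbb{E}^X_{x,T,y}[\mathcal{T}_{(a,b)}]=\int_0^T dt\int_a^b m^X(dz)\,\widehat q_t(x,z)\,\frac{q_{T-t}(z,y)}{q_T(x,y)}.$$
   Context: $X=(X_t)_{t\ge0}$ is a regular diffusion on $I$ in the sense of Itô and McKean, realized as the coordinate process on $C[0,\infty)$ with natural filtration $(\mathcal{C}_t)_{t\ge0}$; $\mathbb{P}^X_x$ is its law started from $x\in I$ and $\mathbb{E}^X_x$ the expectation. There is a speed measure $m^X$ such that $\mathbb{P}^X_x(X_t\in dy)=q_t(x,y)\,m^X(dy)$ with $(t,x,y)\mapsto q_t(x,y)$ continuous and strictly positive for $t>0$, $x,y\in I$. The $X$-bridge from $x$ to $y$ of length $T$ is $X$ started at $x$ and conditioned to be at $y$ at time $T$. It is the (non-homogeneous) Doob $h$-transform of $X$ with $h(z,t)=q_{T-t}(z,y)$; its law $\mathbb{P}^X_{x,T,y}$ (with expectation $\mathbb{E}^X_{x,T,y}$) satisfies, for $t<T$ and $A_t\in\mathcal{C}_t$, $$\mathbb{P}^X_{x,T,y}(A_t)=\mathbb{E}^X_x\Big[\frac{q_{T-t}(X_t,y)}{q_T(x,y)}\,;A_t\Big],$$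 and the bridge takes the value $y$ at time $T$. The first exit time of a continuous process $X$ is $\mathcal{T}_{(a,b)}:=\inf\{t>0:X_t\notin(a,b)\}$, with $\inf\emptyset=\infty$. The killed diffusion has a continuous strictly positive density $\widehat q_t(x,y)$ with respect to $m^X$, characterized for $x,y\in(a,b)$ by $\widehat q_t(x,y)\,m^X(dy)=\mathbb{P}^X_x(X_t\in dy,\ \mathcal{T}_{(a,b)}>t)$. *)

(* Defs.v *)
From HB Require Import structures.
From mathcomp Require Import all_boot all_order all_algebra.
From mathcomp Require Import all_classical all_reals all_analysis.

Set Implicit Arguments.
Unset Strict Implicit.
Unset Printing Implicit Defensive.

Import Order.TTheory GRing.Theory Num.Theory.
Import numFieldNormedType.Exports.

Local Open Scope classical_set_scope.
Local Open Scope ring_scope.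

(* C[0, +oo): a path is identified with its extension to R that is constant
   on ]-oo, 0], so that equality of paths is equality on [0, +oo). *)
Record cpath (R : realType) := CPath {
  path_val :> R -> R;
  path_continuous : continuous path_val;
  path_neg : forall t : R, t < 0 -> path_val t = path_val 0 }.

HB.instance Definition _ (R : realType) := gen_eqMixin (cpath R).
HB.instance Definition _ (R : realType) := gen_choiceMixin (cpath R).

Definition cst_cpath (R : realType) (x : R) : cpath R :=
  CPath (fun t => @cst_continuous R R x t) (fun _ _ => erefl x).

HB.instance Definition _ (R : realType) :=
  isPointed.Build (cpath R) (cst_cpath 0).

Lemma shift_continuous (R : realType) (s : R) (w : cpath R) :
  continuous (fun t : R => w (s + Num.max t 0)).
Proof.
move=> t; apply: (@continuous_comp _ _ _ (fun t : R => s + Num.max t 0) w).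
  apply: (@continuousD _ _ _ (fun=> s) (fun t : R => Num.max t 0)).
    exact: cst_continuous.
  by apply: continuous_max; [exact: cvg_id | exact: cst_continuous].
exact: path_continuous.
Qed.

Lemma shift_neg (R : realType) (s : R) (w : cpath R) (t : R) :
  t < 0 -> w (s + Num.max t 0) = w (s + Num.max 0 0).
Proof. by move=> t0; rewrite maxxx (max_r (ltW t0)). Qed.

(* theta_s w = (w (s + t))_(t >= 0) *)
Definition shift (R : realType) (s : R) (w : cpath R) : cpath R :=
  CPath (@shift_continuous R s w) (@shift_neg R s w).

Definition cylinders (R : realType) (S : set R) : set (set (cpath R)) :=
  [set A | exists s (B : set (measurableTypeR R)),
     [/\ S s, measurable B & A = [set w : cpath R | B (w s)] ] ].

Definition natural_filtration (R : realType) (t : R) : set (set (cpath R)) :=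
  <<s cylinders `[0, t] >>.

Definition all_cylinders (R : realType) : set (set (cpath R)) :=
  cylinders `[0, +oo[.

HB.instance Definition _ (R : realType) :=
  @isMeasurable.Build (sigma_display (@all_cylinders R)) (cpath R)
    <<s @all_cylinders R >> (@sigma_algebra0 _ setT (@all_cylinders R))
    (@sigma_algebraC _ (@all_cylinders R))
    (@sigma_algebra_bigcup _ setT (@all_cylinders R)).

Section times.
Variable R : realType.
Implicit Types (J : set R) (w : cpath R) (tau : cpath R -> \bar R).
Local Open Scope ereal_scope.

(* inf {t > 0 | w t is not in J}, with ereal_inf set0 = +oo *)
Definition exit_time J w : \bar R :=
  ereal_inf (EFin @` [set t : R | (0 < t)%R /\ ~ J (w t)]).

Definition hitting_time (z : R) w : \bar R :=
  ereal_inf (EFin @` [set t : R | (0 < t)%R /\ w t = z]).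

Definition optional_time tau :=
  (forall w, 0 <= tau w) /\
  (forall t : R, (0 < t)%R -> natural_filtration t [set w | tau w < t%:E]).

(* the sigma-field C_(tau+) *)
Definition past_of tau : set (set (cpath R)) :=
  [set A | forall t : R, (0 < t)%R ->
    natural_filtration t (A `&` [set w | tau w < t%:E])].

End times.

(* Regular (conservative) diffusion on the interval I in the sense of Ito and
   McKean. P z is the law started from z; only the P z with z in I are
   constrained, the values of the kernel outside I playing no role. Boundary
   points of I need not be reachable from the interior (entrance points). *)
Record regular_diffusion (R : realType) (I : set R)
    (P : R.-pker (measurableTypeR R) ~> cpath R) : Prop := {
  diffusion_interval : is_interval I;
  diffusion_start : forall x : R, I x -> P x [set w : cpath R | w 0 = x] = 1%E;
  diffusion_state : forall x : R, I x ->
    P x [set w : cpath R | forall t : R, 0 <= t -> I (w t)] = 1%E;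
  diffusion_strong_markov : forall (x : R) (tau : cpath R -> \bar R)
      (A B : set (cpath R)),
    I x -> optional_time tau -> past_of tau A -> measurable B ->
    (P x (A `&` [set w | tau w < +oo] `&`
          [set w | B (shift (fine (tau w)) w)]) =
     \int[P x]_(w in A `&` [set w | tau w < +oo])
        P (w (fine (tau w))) B)%E;
  diffusion_regular : forall x z : R, I° x -> I° z ->
    (0 < P x [set w | hitting_time z w < +oo])%E }.

Section speed_measure.
Variables (R : realType) (I : set R).
Variable P : R.-pker (measurableTypeR R) ~> cpath R.

Record is_scale_function (s : R -> R) : Prop := {
  scale_continuous : {within I°, continuous s};
  scale_increasing : forall u v : R, I° u -> I° v -> u < v -> s u < s v;
  scale_exit : forall a b x : R, I° a -> I° b -> a < x < b ->
    P x [set w | (hitting_time b w < hitting_time a w)%E] =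
    ((s x - s a) / (s b - s a))%:E }.

(* Green function of the diffusion killed on leaving ]a, b[, for the scale s *)
Definition green (s : R -> R) (a b x z : R) : R :=
  (s (Num.min x z) - s a) * (s b - s (Num.max x z)) / (s b - s a).

(* Only the restriction of m to I matters. This fixes m on the interior of I
   up to the normalization (s, m) |-> (c s, m / c); a possible mass at a
   boundary point belonging to I is then fixed by transition_density. *)
Definition is_speed_measure (m : {measure set (measurableTypeR R) -> \bar R}) :=
  exists2 s : R -> R, is_scale_function s &
    forall a b x : R, I° a -> I° b -> a < x < b ->
      (\int[P x]_w exit_time `]a, b[ w =
       \int[m]_(z in `]a, b[) (green s a b x z)%:E)%E.

Record transition_density (m : {measure set (measurableTypeR R) -> \bar R})
    (q : R -> R -> R -> R) : Prop := {
  density_continuous :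
    {within [set u : R * R * R | [/\ 0 < u.1.1, I u.1.2 & I u.2]],
      continuous (fun u : R * R * R => q u.1.1 u.1.2 u.2)};
  density_gt0 : forall t x y : R, 0 < t -> I x -> I y -> 0 < q t x y;
  density_law : forall (t x : R) (B : set (measurableTypeR R)),
    0 < t -> I x -> measurable B -> B `<=` I ->
    P x [set w : cpath R | B (w t)] = (\int[m]_(y in B) (q t x y)%:E)%E }.

Record killed_density (m : {measure set (measurableTypeR R) -> \bar R})
    (J : set R) (qk : R -> R -> R -> R) : Prop := {
  killed_continuous :
    {within [set u : R * R * R | [/\ 0 < u.1.1, J u.1.2 & J u.2]],
      continuous (fun u : R * R * R => qk u.1.1 u.1.2 u.2)};
  killed_gt0 : forall t x y : R, 0 < t -> J x -> J y -> 0 < qk t x y;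
  killed_law : forall (t x : R) (B : set (measurableTypeR R)),
    0 < t -> J x -> measurable B -> B `<=` J ->
    P x [set w : cpath R | B (w t) /\ (t%:E < exit_time J w)%E] =
    (\int[m]_(y in B) (qk t x y)%:E)%E }.

(* Pbr is the law of the bridge from x to y of length T: the h-transform with
   h (z, t) = q (T - t) z y, arriving at y at time T. The behaviour of the path
   after T is left free. Under P x one has w t in I almost surely; this is
   recorded in the domain of integration because q is only meaningful on I. *)
Record bridge_law (q : R -> R -> R -> R) (x T y : R)
    (Pbr : probability (cpath R) R) : Prop := {
  bridge_htransform : forall (t : R) (A : set (cpath R)),
    0 <= t -> t < T -> natural_filtration t A ->
    Pbr A = (\int[P x]_(w in A `&` [set w : cpath R | I (w t)])
               (q (T - t) (w t) y / q T x y)%:E)%E;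
  bridge_end : Pbr [set w : cpath R | w T = y] = 1%E }.

End speed_measure.

(* ]a, b[ in R, with possibly infinite endpoints *)
Definition open_itv (R : realType) (a b : \bar R) : set R :=
  [set z : R | (a < z%:E < b)%E].

(* Main.v *)
Require Import Defs.
From HB Require Import structures.
From mathcomp Require Import all_boot all_order all_algebra.
From mathcomp Require Import all_classical all_reals all_analysis.
From mathcomp Require Import measurable_realfun.
From mathcomp Require Import lra.

(** The expectation of a nonnegative variable is the integral of its tail, so
    the mean exit time tau of the bridge is the integral over t > 0 of its
    probability of {t < tau} ([ge0_integral_tail]). The bridge sits at y,
    outside ]a, b[, at time T, hence tau <= T almost surely and only
    t < T contributes ([bridge_exit_tail0]).

    For t < T, the event {t < tau} says that the path stays in ]a, b[ during
    ]0, t]; by continuity this is decided by countably many coordinates up to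
    time t, so it belongs to the natural filtration at t
    ([natural_filtration_lt_exit_time]). The h-transform formula then gives
    its bridge probability as the expectation, under the law of the diffusion
    and on {t < tau}, of q (T - t) (w t) y / q T x y. On {t < tau} the law of
    w t has density qk t x with respect to m, and integrating against that
    density ([ge0_integral_density]) produces the inner integral
    ([bridge_exit_tail]). *)

Set Implicit Arguments.
Unset Strict Implicit.
Unset Printing Implicit Defensive.

Import Order.TTheory GRing.Theory Num.Theory.
Import numFieldNormedType.Exports.

Local Open Scope classical_set_scope.
Local Open Scope ring_scope.

(** * Exit times of continuous paths *)

Lemma measurable_coordinate (R : realType) (t : R) : 0 <= t ->
  measurable_fun [set: cpath R] (fun w : cpath R => w t : measurableTypeR R).
Proof.
move=> t0 _ B mB; rewrite setTI; apply: sub_sigma_algebra.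
by exists t, B; split => //=; rewrite in_itv/= t0.
Qed.

Lemma natural_filtration_measurable (R : realType) (t : R)
  (A : set (cpath R)) : natural_filtration t A -> measurable A.
Proof.
apply: sub_smallest2r; first exact: smallest_sigma_algebra.
move=> _ [s [B [/= st mB ->]]]; exists s, B; split => //=.
by move: st; rewrite !in_itv/= => /andP[->].
Qed.

Lemma exit_time_ge0 (R : realType) (J : set R) (w : cpath R) :
  (0 <= exit_time J w)%E.
Proof.
by apply/ereal_infP => _ [t [t0 _] <-]; rewrite lee_fin ltW.
Qed.

(** Openness of J is what makes the closed end t legitimate: a path that is
    still in J at time t stays there a little longer, so its exit time
    is not t. *)
Lemma lt_exit_timeP (R : realType) (J : set R) (w : cpath R) (t : R) :
  open J -> 0 < t ->
  (t%:E < exit_time J w)%E <-> (forall s, 0 < s <= t -> J (w s)).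
Proof.
move=> oJ t0; split => [tw s /andP[s0 st]|Jw].
  apply: contrapT => NJ; move: tw; rewrite ltNge => /negP; apply.
  apply: (@le_trans _ _ s%:E); last by rewrite lee_fin.
  by apply: ereal_inf_lbound; exists s.
have : \forall s \near t, J (w s).
  apply: (@path_continuous R w t).
  by apply: open_nbhs_nbhs; split => //; apply: Jw; rewrite t0 lexx.
move=> /nbhs_ballP[e /= e0 Je].
apply: (@lt_le_trans _ _ (t + e)%:E); first by rewrite lte_fin ltrDl.
apply/ereal_infP => _ [s [s0 NJ] <-]; rewrite lee_fin leNgt; apply/negP => ste.
apply: NJ; have [st|ts] := leP s t; first by apply: Jw; rewrite s0.
by apply: Je; rewrite /ball/= ltr_distl; apply/andP; split; lra.
Qed.

Lemma dense_ratr_closed (R : realType) (C : set R) :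
  closed C -> (forall p : rat, C (ratr p)) -> C = setT.
Proof.
move=> cC Cq; apply/seteqP; split => // r _; apply: contrapT => NC.
have [z [NCz [p _ pz]]] :=
  dense_rat (ex_intro (~` C) r NC) (closed_openC cC).
by apply: NCz; rewrite -pz.
Qed.

(** The range of a continuous path over a segment is compact, so if it lies in
    the open interval J it lies between two rationals of J; and those weak
    inequalities need only be tested at rational times. Times are clamped to
    [c, t] rather than restricted to it, so that density of the rationals in
    the whole line suffices, whatever c and t. *)
Lemma segment_in_openP (R : realType) (J : set R) (w : cpath R) (c t : R) :
  open J -> is_interval J -> c <= t ->
  (forall s, c <= s <= t -> J (w s)) <->
  (exists p r : rat, [/\ J (ratr p), J (ratr r) &
    forall v : rat,
      ratr p <= w (Num.max c (Num.min t (ratr v))) <= ratr r]).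
Proof.
move=> oJ iJ ct; split => [Jw|[p [r [Jp Jr wpr]]] s /andP[cs st]].
  have wc : {within `[c, t], continuous w}.
    exact/continuous_subspaceT/path_continuous.
  have clamp v : Num.max c (Num.min t v) \in `[c, t].
    by rewrite in_itv/= le_max lexx/= ge_max ct ge_min lexx.
  have [cmin cminI wmin] := EVT_min ct wc.
  have [cmax cmaxI wmax] := EVT_max ct wc.
  have /nbhs_ballP[e /= e0 Je] : nbhs (w cmin) J.
    apply: open_nbhs_nbhs; split => //; apply: Jw.
    by move: cminI; rewrite in_itv.
  have /nbhs_ballP[f /= f0 Jf] : nbhs (w cmax) J.
    apply: open_nbhs_nbhs; split => //; apply: Jw.
    by move: cmaxI; rewrite in_itv.
  have /rat_in_itvoo[p] : w cmin - e < w cmin by lra.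
  rewrite in_itv/= => /andP[pe pm].
  have /rat_in_itvoo[r] : w cmax < w cmax + f by lra.
  rewrite in_itv/= => /andP[rm rf].
  exists p, r; split.
  - by apply: Je; rewrite /ball/= ltr_distlC; apply/andP; split; lra.
  - by apply: Jf; rewrite /ball/= ltr_distlC; apply/andP; split; lra.
  - move=> v; rewrite (le_trans (ltW pm) (wmin _ (clamp _)))/=.
    exact: le_trans (wmax _ (clamp _)) (ltW rm).
have : (fun v : R => w (Num.max c (Num.min t v))) @^-1` `[ratr p, ratr r]
  = setT.
  apply: dense_ratr_closed; last by move=> v /=; rewrite in_itv/=.
  apply: preimage_closed; last exact: itv_closed.
  move=> v _; apply: (@continuous_comp _ _ _
    (fun v : R => Num.max c (Num.min t v)) w); last exact: path_continuous.
  apply: continuous_max; first exact: cst_continuous.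
  by apply: continuous_min; [exact: cst_continuous|exact: cvg_id].
move=> /seteqP[_ /(_ s I)] /=.
rewrite in_itv/= (min_r st) (max_r cs) => pwr.
exact: iJ Jp Jr _ pwr.
Qed.

Lemma countable_bigcapT_measurable d (T : measurableType d) (U : Type)
  (F : U -> set T) : countable [set: U] -> (forall i, measurable (F i)) ->
  measurable (\bigcap_i F i).
Proof.
move=> cU mF; rewrite -[X in measurable X]setCK setC_bigcap.
apply: measurableC; apply: countable_bigcupT_measurable => // i.
exact: measurableC.
Qed.

Lemma natural_filtration_segment (R : realType) (J : set R) (c t : R) :
  open J -> is_interval J -> 0 < c -> c <= t ->
  natural_filtration t [set w : cpath R | forall s, c <= s <= t -> J (w s)].
Proof.
move=> oJ iJ c0 ct.
pose G := @cylinders R `[0, t].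
pose F (pr : rat * rat) (v : rat) : set (cpath R) :=
  [set w | ratr pr.1 <= w (Num.max c (Num.min t (ratr v))) <= ratr pr.2].
pose E (pr : rat * rat) : set (cpath R) :=
  if pselect (J (ratr pr.1) /\ J (ratr pr.2)) then \bigcap_v F pr v else set0.
rewrite (_ : [set w | _] = \bigcup_pr E pr); last first.
  apply/seteqP; split => w /=.
    move/(segment_in_openP _ oJ iJ ct) => [p [r [Jp Jr wpr]]].
    exists (p, r) => //; rewrite /E.
    by case: pselect => [_ v _|[]//]; exact: wpr.
  move=> [[p r] _]; rewrite /E; case: pselect => //= -[Jp Jr] wpr.
  apply/(segment_in_openP _ oJ iJ ct); exists p, r; split => // v.
  exact: wpr.
suff : G.-sigma.-measurable (\bigcup_pr E pr) by [].
apply: countable_bigcupT_measurable => [|pr]; first exact: countableP.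
rewrite /E; case: pselect => JJ; last exact: measurable0.
apply: countable_bigcapT_measurable => [|v]; first exact: countableP.
apply: sub_sigma_algebra.
exists (Num.max c (Num.min t (ratr v))), `[ratr pr.1, ratr pr.2]%classic.
split; last by apply/seteqP; split => w /=; rewrite in_itv.
  by rewrite /= in_itv/= le_max (ltW c0)/= ge_max ct ge_min lexx.
exact: measurable_itv.
Qed.

(** Compactness controls segments [c, t] with c > 0 only, while the condition on
    the path bears on ]0, t]: the latter is exhausted by c = t / (n + 1). Time 0
    has to stay out: the path may start outside J. *)
Lemma natural_filtration_lt_exit_time (R : realType) (J : set R) (t : R) :
  open J -> is_interval J -> 0 < t ->
  natural_filtration t [set w : cpath R | (t%:E < exit_time J w)%E].
Proof.
move=> oJ iJ t0; pose c (n : nat) : R := t / n.+1%:R.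
have c0 n : 0 < c n by rewrite divr_gt0.
have ct n : c n <= t by rewrite ler_pdivrMr// ler_peMr ?ler1n// ltW.
rewrite (_ : [set w | _] =
    \bigcap_n [set w : cpath R | forall s, c n <= s <= t -> J (w s)]).
  suff : (@cylinders R `[0, t]).-sigma.-measurable
      (\bigcap_n [set w : cpath R | forall s, c n <= s <= t -> J (w s)]) by [].
  by apply: bigcapT_measurable => n; exact: natural_filtration_segment.
apply/seteqP; split => w /=.
  move=> /(lt_exit_timeP _ oJ t0) Jw n _ s /andP[cs st]; apply: Jw.
  by rewrite (lt_le_trans (c0 n) cs).
move=> Jw; apply/(lt_exit_timeP _ oJ t0) => s /andP[s0 st].
apply: (Jw (Num.truncn (t / s))) => //; rewrite st andbT /c.
rewrite ler_pdivrMr// mulrC -ler_pdivrMr//.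
exact/ltW/truncnS_gt.
Qed.

Lemma measurable_exit_time (R : realType) (J : set R) :
  open J -> is_interval J -> measurable_fun [set: cpath R] (exit_time J).
Proof.
move=> oJ iJ mT; apply: (measurability _ (ErealGenOInfty.measurableE R)) => //.
have mlt t : 0 < t -> measurable [set w : cpath R | (t%:E < exit_time J w)%E].
  move=> t0; apply: (@natural_filtration_measurable R t).
  exact: natural_filtration_lt_exit_time.
move=> _ [_ [r ->] <-]; rewrite setTI.
have [r0|r0] := ltP r 0.
  rewrite (_ : _ @^-1` _ = setT); first exact: measurableT.
  apply/seteqP; split => // w _ /=; rewrite in_itv/= andbT.
  by rewrite (lt_le_trans _ (exit_time_ge0 _ _))// lte_fin.
(* At r = 0 the tail events at positive times are the only ones available:
   approach r from above. *)
rewrite (_ : _ @^-1` _ =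
    \bigcup_n [set w | ((r + n.+1%:R^-1)%:E < exit_time J w)%E]).
  by apply: bigcupT_measurable => n; apply: mlt; rewrite ltr_wpDl.
apply/seteqP; split => w /=; rewrite in_itv/= andbT; last first.
  by move=> [n _]; apply: lt_trans; rewrite lte_fin ltrDl.
case wE: (exit_time J w) => [s||//] rs; last first.
  by exists 0%N => //=; rewrite wE ltry.
rewrite lte_fin in rs; exists (Num.truncn (s - r)^-1) => //=.
rewrite wE lte_fin -ltrBrDl invf_plt ?posrE ?subr_gt0//.
exact: truncnS_gt.
Qed.

Lemma open_open_itv (R : realType) (a b : \bar R) : open (open_itv a b).
Proof.
rewrite (_ : open_itv a b =
  [set z | (a < z%:E)%E] `&` [set z | (z%:E < b)%E]); last first.
  by apply/seteqP; split => z /= => [/andP[]//|[az zb]]; apply/andP.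
by apply: openI; [exact: open_ereal_gt|exact: open_ereal_lt].
Qed.

Lemma is_interval_open_itv (R : realType) (a b : \bar R) :
  is_interval (open_itv a b).
Proof.
move=> u v /andP[au _] /andP[_ vb] z /andP[uz zv]; apply/andP; split.
  by rewrite (lt_le_trans au).
by rewrite (le_lt_trans _ vb).
Qed.

(** * Tails and densities *)

(** Both sides compute the measure of the region under the graph of X, the set
    of the (w, t) with 0 < t < X w: slice it at w for the left-hand side and
    at t for the right-hand side. *)
Lemma ge0_integral_tail d (T : measurableType d) (R : realType)
  (P : {sigma_finite_measure set T -> \bar R}) (X : T -> \bar R) :
  measurable_fun [set: T] X -> (forall w, 0 <= X w)%E ->
  (\int[P]_w X w =
   \int[lebesgue_measure]_(t in `]0%R, +oo[) P [set w | t%:E < X w])%E.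
Proof.
move=> mX X0.
pose E : set (T * measurableTypeR R) :=
  [set u | 0%:E < u.2%:E]%E `&` [set u | u.2%:E < X u.1]%E.
have mE : measurable E.
  have msnd : measurable_fun setT
      (fun u : T * measurableTypeR R => u.2%:E : \bar R).
    by apply: measurableT_comp => //; exact: measurable_snd.
  apply: measurableI; rewrite -[X in measurable X]setTI.
    exact: (@measurable_lte _ _ _ _ _ (cst 0%E)).
  apply: measurable_lte => //.
  by apply: measurableT_comp => //; exact: measurable_fst.
have mf : measurable_fun setT
    (fun u : T * measurableTypeR R => (\1_E u : R)%:E).
  exact/measurable_EFinP/measurable_indic.
transitivity (\int[P]_w \int[lebesgue_measure]_t (\1_E (w, t) : R)%:E)%E.
  apply: eq_integral => w _.
  rewrite (_ : (fun t => _) = (fun t => (\1_([set t | E (w, t)]) t : R)%:E)).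
    rewrite integral_indic//; last first.
      have := measurable_xsection w mE.
      by congr measurable; apply/seteqP; split => t /=; rewrite /xsection/= inE.
    rewrite setIT.
    case wE : (X w) => [s||]; last by have := X0 w; rewrite wE.
    - rewrite (_ : [set _ | _] = `]0, s[%classic); last first.
        by apply/seteqP; split => t /=;
          rewrite /E/= wE in_itv/= !lte_fin;
          [move=> [-> ->]|move=> /andP[]].
      apply/esym/(eq_trans (lebesgue_measure_itv `]0, s[)); rewrite /= lte_fin.
      have := X0 w; rewrite wE lee_fin le_eqVlt => /predU1P[<-|->].
        by rewrite ltxx.
      by rewrite sube0.
    - rewrite (_ : [set _ | _] = `]0, +oo[%classic); last first.
        by apply/seteqP; split => t /=;
          rewrite /E/= wE in_itv/= ?andbT !lte_fin ltry;
          [move=> []|].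
      apply/esym/(eq_trans (lebesgue_measure_itv `]0, +oo[)).
      by rewrite /= ltry.
  by apply/funext => t; rewrite !indicE.
rewrite (fubini_tonelli (fun u => (\1_E u : R)%:E))//=.
rewrite [RHS]integral_mkcond; apply: eq_integral => t _; rewrite patchE.
rewrite mem_setE in_itv/= andbT.
case: ifPn => t0.
  rewrite -[in RHS](setIT [set w | _]) -integral_indic//; last first.
    by rewrite -[X in measurable X]setTI; apply: measurable_lte.
  apply: eq_integral => w _; congr EFin; rewrite !indicE; congr (_%:R).
  congr nat_of_bool; apply/idP/idP; rewrite !inE /E/= lte_fin.
    by move=> [].
  by move=> ->.
apply: integral0_eq => w _; rewrite indicE memNset// /E/= lte_fin.
by move=> [] /idP; rewrite (negbTE t0).
Qed.

(** [law] states that f is the density with respect to m of the image by X of mu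
    restricted to A, tested only on subsets of D. The restricted image
    measure is not formed: integrals against it are written on S directly, and
    the identity climbs from indicators to nonnegative measurable functions. *)
Section integral_density.
Context d1 d2 (S : measurableType d1) (T : measurableType d2) (R : realType).
Variables (mu : {measure set S -> \bar R}) (m : {measure set T -> \bar R}).
Variables (X : S -> T) (A : set S) (D : set T) (f : T -> R).
Hypotheses (mX : measurable_fun [set: S] X) (mA : measurable A).
Hypotheses (mD : measurable D) (mf : measurable_fun D f).
Hypothesis f0 : forall z, D z -> 0 <= f z.
Hypothesis law : forall B, measurable B -> B `<=` D ->
  (mu (A `&` X @^-1` B) = \int[m]_(z in B) (f z)%:E)%E.

Import HBNNSimple.

Let mXpre B : measurable B -> measurable (X @^-1` B).
Proof. by move=> mB; rewrite -[X in measurable X]setTI; exact: mX. Qed.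

Let mXA : measurable (A `&` X @^-1` D).
Proof. by apply: measurableI => //; exact: mXpre. Qed.

Lemma integral_density_indic (B : set T) : measurable B ->
  (\int[mu]_(w in A `&` X @^-1` D) (\1_B (X w) : R)%:E =
   \int[m]_(z in D) (f z * \1_B z)%:E)%E.
Proof.
move=> mB.
transitivity (mu (X @^-1` B `&` (A `&` X @^-1` D))).
  rewrite -integral_indic//; last exact: mXpre.
transitivity (mu (A `&` X @^-1` (D `&` B))).
  by congr (mu _); apply/seteqP; split => w /=; tauto.
rewrite law//; last exact: measurableI.
rewrite integral_mkcondr; apply: eq_integral => z _.
by rewrite patchE indicE; case: ifPn => _; rewrite ?mulr1 ?mulr0.
Qed.

Lemma integral_density_nnsfun (h : {nnsfun T >-> R}) :
  (\int[mu]_(w in A `&` X @^-1` D) (h (X w))%:E =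
   \int[m]_(z in D) (f z * h z)%:E)%E.
Proof.
have mh r : measurable (h @^-1` [set r]) by exact: measurable_sfunP.
have m1 r : measurable_fun D (\1_(h @^-1` [set r]) : T -> R).
  by apply: measurable_funTS; exact: measurable_indic.
have m1X r : measurable_fun (A `&` X @^-1` D)
    (fun w => \1_(h @^-1` [set r]) (X w) : R).
  apply: measurable_funTS.
  by apply: measurableT_comp => //; exact: measurable_indic.
transitivity (\sum_(r \in range h) \int[mu]_(w in A `&` X @^-1` D)
    (r%:E * (\1_(h @^-1` [set r]) (X w) : R)%:E))%E.
  rewrite -ge0_integral_fsum//.
  - by apply: eq_integral => w _; rewrite fsumEFin// -fimfunE.
  - by move=> r; apply/measurable_EFinP; apply: measurable_funM.
  - by move=> r w _; rewrite -EFinM nnfun_muleindic_ge0.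
transitivity (\sum_(r \in range h)
    \int[m]_(z in D) (r%:E * (f z * \1_(h @^-1` [set r]) z)%:E))%E; last first.
  rewrite -ge0_integral_fsum//.
  - apply: eq_integral => z _; rewrite fsumEFin// [in RHS](fimfunE h).
    rewrite mulr_fsumr//; congr EFin.
    by apply: eq_fsbigr => r _; rewrite mulrCA.
  - move=> r; apply/measurable_EFinP; apply: measurable_funM => //.
    exact: measurable_funM.
  - move=> r z Dz; rewrite -EFinM mulrCA EFinM mule_ge0//.
      by rewrite lee_fin f0.
    exact: nnfun_muleindic_ge0.
apply: eq_fsbigr => r; rewrite inE => -[z0 _ hr].
have r0 : 0 <= r by rewrite -hr.
rewrite ge0_integralZl_EFin//; last exact/measurable_EFinP.
rewrite integral_density_indic// ge0_integralZl_EFin//.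
- by move=> z Dz; rewrite lee_fin mulr_ge0// f0.
- by apply/measurable_EFinP; exact: measurable_funM.
Qed.

Lemma ge0_integral_density (g : T -> R) :
  measurable_fun D g -> (forall z, D z -> 0 <= g z) ->
  (\int[mu]_(w in A `&` X @^-1` D) (g (X w))%:E =
   \int[m]_(z in D) (f z * g z)%:E)%E.
Proof.
move=> mg g0.
have mG : measurable_fun D (EFin \o g) by exact/measurable_EFinP.
pose h := nnsfun_approx mD mG.
have h_cvg z : D z -> (h n z)%:E @[n --> \oo] --> (g z)%:E.
  by move=> Dz; exact: (cvg_nnsfun_approx mD mG).
have h_nd z n k : (n <= k)%N -> h n z <= h k z.
  by move=> nk; exact/lefP/nd_nnsfun_approx.
transitivity (limn (fun n =>
    \int[mu]_(w in A `&` X @^-1` D) (h n (X w))%:E))%E.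
  rewrite -monotone_convergence//.
  - apply: eq_integral => w; rewrite inE => -[_ Dw]; apply/esym/cvg_lim => //.
    exact: h_cvg.
  - move=> n; apply/measurable_EFinP; apply: measurable_funTS.
    by apply: measurableT_comp => //; exact: measurable_funPT.
  - by move=> n w _; rewrite lee_fin.
  - by move=> w _ n k nk; rewrite lee_fin h_nd.
under eq_fun do rewrite integral_density_nnsfun.
rewrite -monotone_convergence//.
- apply: eq_integral => z; rewrite inE => Dz; apply/cvg_lim => //.
  under eq_fun do rewrite EFinM.
  by rewrite EFinM; apply: cvgeZl => //; exact: h_cvg.
- move=> n; apply/measurable_EFinP; apply: measurable_funM => //.
  by apply: measurable_funTS; exact: measurable_funPT.
- by move=> n z Dz; rewrite lee_fin mulr_ge0// f0.
- by move=> z Dz n k nk; rewrite lee_fin ler_wpM2l ?f0// h_nd.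
Qed.

End integral_density.

(** * Exit of the bridge *)

Lemma continuous_pair (T U V : topologicalType) (f : T -> U) (g : T -> V) :
  continuous f -> continuous g -> continuous (fun z => (f z, g z)).
Proof. by move=> cf cg z; exact: (cvg_pair (cf z) (cg z)). Qed.

Lemma within_continuous_comp (T U V : topologicalType) (A : set T) (B : set U)
  (phi : T -> U) (F : U -> V) :
  continuous phi -> (forall z, A z -> B (phi z)) ->
  {within B, continuous F} -> {within A, continuous (F \o phi)}.
Proof.
move=> cphi AB /subspace_continuousP cF; apply/subspace_continuousP => z Az.
apply: (@cvg_comp _ _ _ phi F _ (within B (nbhs (phi z)))); last first.
  by apply: cF; exact: AB.
move=> C BC; have phiC : nbhs z [set u | B (phi u) -> C (phi u)].
  exact: cphi BC.
suff : nbhs z [set u | A u -> C (phi u)] by [].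
by apply: filterS phiC => u BCu Au; apply: BCu; exact: AB.
Qed.

Section bridge_exit.
Variables (R : realType) (I : set R).
Variable P : R.-pker (measurableTypeR R) ~> cpath R.
Variable m : {measure set (measurableTypeR R) -> \bar R}.
Variables (q qk : R -> R -> R -> R) (T x y : R) (J : set R).
Variable Pbr : probability (cpath R) R.
Hypotheses (qP : transition_density I P m q) (qkP : killed_density P m J qk).
Hypothesis brP : bridge_law I P q x T y Pbr.
Hypotheses (oJ : open J) (iJ : is_interval J) (JI : J `<=` I).
Hypotheses (Jx : J x) (Iy : I y) (NJy : ~ J y) (T0 : 0 < T).

(** On {t < tau} the position w t lies in J, hence in I: the domain of the
    h-transform formula and the domain where the killed density describes
    the law of w t are the same event. *)
Lemma bridge_exit_tail (t : R) : 0 < t -> t < T ->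
  (Pbr [set w | t%:E < exit_time J w] =
   \int[m]_(z in J) (qk t x z * (q (T - t) z y / q T x y))%:E)%E.
Proof.
move=> t0 tT.
have Tt0 : 0 < T - t by rewrite subr_gt0.
have qT0 : 0 < q T x y by apply: (density_gt0 qP) => //; exact: JI.
pose X (w : cpath R) : measurableTypeR R := w t.
pose A : set (cpath R) := [set w | (t%:E < exit_time J w)%E].
have FA : natural_filtration t A by exact: natural_filtration_lt_exit_time.
have AJ w : A w -> J (w t).
  by move=> /(lt_exit_timeP _ oJ t0); apply; rewrite t0 lexx.
rewrite (bridge_htransform brP (ltW t0) tT FA).
rewrite (_ : A `&` _ = A `&` X @^-1` J); last first.
  by apply/seteqP; split => w [Aw _]; split => //; [exact: AJ|exact/JI/AJ].
apply: (@ge0_integral_density _ _ _ _ _ (P x) m X A J (qk t x) _ _ _ _ _ _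
  (fun z => q (T - t) z y / q T x y)).
- exact: measurable_coordinate (ltW t0).
- exact: natural_filtration_measurable FA.
- exact: open_measurable.
- apply: subspace_continuous_measurable_fun; first exact: open_measurable.
  apply: (@within_continuous_comp _ _ _ _ _ (fun z : R => (t, x, z))
    (fun u => qk u.1.1 u.1.2 u.2) _ _ (killed_continuous qkP)) => //.
  by apply: continuous_pair => z; [exact: cvg_cst|exact: cvg_id].
- by move=> z Jz; rewrite ltW// (killed_gt0 qkP).
- move=> B mB BJ; rewrite -(killed_law qkP t0 Jx mB BJ).
  by congr (P x _); apply/seteqP; split => w [].
- apply: measurable_funM => //.
  apply: subspace_continuous_measurable_fun; first exact: open_measurable.
  apply: (@within_continuous_comp _ _ _ _ _ (fun z : R => (T - t, z, y))
    (fun u => q u.1.1 u.1.2 u.2) _ _ (density_continuous qP)).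
  + apply: continuous_pair; last by move=> z; exact: cvg_cst.
    by apply: continuous_pair => z; [exact: cvg_cst|exact: cvg_id].
  + by move=> z Jz; split => //=; exact: JI.
- by move=> z Jz; rewrite ltW// divr_gt0// (density_gt0 qP)//; exact: JI.
Qed.

Lemma bridge_exit_tail0 (t : R) : T <= t ->
  Pbr [set w | t%:E < exit_time J w]%E = 0%E.
Proof.
move=> Tt.
have t0 : 0 < t by exact: lt_le_trans Tt.
have mend : measurable [set w : cpath R | w T = y].
  have := measurable_coordinate (ltW T0) measurableT (measurable_set1 y).
  by rewrite setTI.
have end0 : Pbr (~` [set w : cpath R | w T = y]) = 0%E.
  by rewrite probability_setC// (bridge_end brP) subee.
apply: (subset_measure0 _ _ _ end0).
- apply: (@natural_filtration_measurable _ t).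
  exact: natural_filtration_lt_exit_time.
- exact: measurableC.
- move=> w /(lt_exit_timeP _ oJ t0) Jw wTy; apply: NJy; rewrite -wTy.
  by apply: Jw; rewrite T0.
Qed.

End bridge_exit.

Theorem proposition2p2 (R : realType) (I : set R)
  (P : R.-pker (measurableTypeR R) ~> cpath R)
  (m : {sigma_finite_measure set (measurableTypeR R) -> \bar R})
  (q qk : R -> R -> R -> R) (T x y : R) (a b : \bar R)
  (Pbr : probability (cpath R) R) :
  regular_diffusion I P ->
  is_speed_measure I P m ->
  transition_density I P m q ->
  0 < T ->
  open_itv a b x -> open_itv a b `<=` I ->
  I y -> ~ open_itv a b y ->
  killed_density P m (open_itv a b) qk ->
  bridge_law I P q x T y Pbr ->
  (\int[Pbr]_w exit_time (open_itv a b) w =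
   \int[lebesgue_measure]_(t in `]0%R, T[)
     \int[m]_(z in open_itv a b)
       (qk t x z * (q (T - t) z y / q T x y))%:E)%E.
Proof.
move=> _ _ qP T0 abx abI Iy Naby qkP brP.
have oab := @open_open_itv _ a b; have iab := @is_interval_open_itv _ a b.
rewrite (ge0_integral_tail Pbr (measurable_exit_time oab iab)); last first.
  exact: exit_time_ge0.
rewrite [LHS]integral_mkcond [RHS]integral_mkcond.
apply: eq_integral => t _; rewrite !patchE !mem_setE !in_itv/= andbT.
have [t0|//] := ltP 0 t; have [tT|Tt] /= := ltP t T.
  exact: (bridge_exit_tail qP qkP brP).
exact: (bridge_exit_tail0 brP).
Qed.
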